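(* Let $G$ be a finite regular partial cube that is not isomorphic to $K_1$ or $K_2$. Then every convex cycle of $G$ is a $4$-cycle if and only if $G$ is isomorphic to a hypercube $Q_k$ for some $k\geqslant 2$.
   Context: All graphs are finite, simple and undirected. The hypercube $Q_n$ has as vertices all 0-1 sequences of length $n$, two being adjacent iff they differ in exactly one position. A subgraph $H$ of $G$ is isometric if $d_H(u,v)=d_G(u,v)$ for all $u,v\in V(H)$, and convex if moreover every shortest $u,v$-path in $G$ (for $u,v\in V(H)$) lies in $H$. A partial cube is a graph isomorphic to an isometric subgraph of some hypercube $Q_n$. A convex cycle is a cycle that is a convex subgraph; an $l$-cycle is a cycle with $l$ edges. A graph is regular if all its vertices have the same degree. *)

(* Defs.v *)
(* Finite simple graphs as symmetric irreflexive relations on a finType. *)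
From mathcomp Require Import all_boot.
Set Implicit Arguments. Unset Strict Implicit. Unset Printing Implicit Defensive.

Definition walk (T : eqType) (e : rel T) (u v : T) (k : nat) : Prop :=
  exists p : seq T, [/\ size p = k, path e u p & last u p = v].

Definition dist (T : eqType) (e : rel T) (u v : T) (d : nat) : Prop :=
  walk e u v d /\ forall k, walk e u v k -> d <= k.

Definition graph_iso (T1 T2 : finType) (e1 : rel T1) (e2 : rel T2) : Prop :=
  exists f : T1 -> T2, bijective f /\ forall x y, e1 x y = e2 (f x) (f y).

Definition Kadj (n : nat) : rel 'I_n := fun x y => x != y.

Definition cube (n : nat) := {ffun 'I_n -> bool}.
Definition Qadj (n : nat) : rel (cube n) :=
  fun x y => #|[set i | x i != y i]| == 1.

Definition partial_cube (T : finType) (e : rel T) : Prop :=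
  exists n (f : T -> cube n),
    forall u v, exists d, dist e u v d /\ dist (@Qadj n) (f u) (f v) d.

Definition regular (T : finType) (e : rel T) : Prop :=
  exists r, forall v : T, #|[set w | e v w]| = r.

Definition is_cycle (T : finType) (e : rel T) (c : seq T) : Prop :=
  [/\ 3 <= size c, uniq c & cycle e c].

Definition cycle_adj (T : finType) (c : seq T) : rel T :=
  fun x y => [&& x \in c, y \in c & (next c x == y) || (next c y == x)].

Definition convex_cycle (T : finType) (e : rel T) (c : seq T) : Prop :=
  is_cycle e c /\
  (forall u v, u \in c -> v \in c ->
     forall d, dist e u v d <-> dist (cycle_adj c) u v d) /\
  (forall u v, u \in c -> v \in c -> forall d, dist e u v d ->
     forall p : seq T, size p = d -> path e u p -> last u p = v ->
       path (cycle_adj c) u p).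

(* Main.v *)
Require Import Defs.
From mathcomp Require Import all_boot zify.
Set Implicit Arguments. Unset Strict Implicit. Unset Printing Implicit Defensive.

(* Let S be the set of vertices of G inside a hypercube.  If a and c carry edges
   of the same direction i, on the same side, and no vertex strictly between them
   does, then the interval of S spanned by these two edges is a convex cycle.
   Hence, if all convex cycles are 4-cycles, the endpoints of the edges of
   direction i span, on either side, an isometric subgraph.  A path in which no
   two consecutive edges lie in a square is then the unique geodesic between its
   ends, so its directions are distinct.  If G is regular, then two incident
   edges not in a square can be prolonged to an infinite such path, by comparing
   the numbers of directions available at the ends of an edge.  As G is finite,
   any two incident edges lie in a square, which makes G a hypercube. *)

(** * Hamming distance and intervals in the hypercube *)

Section Hamming.
Variable n : nat.
Implicit Types (a b c z : cube n) (i j : 'I_n).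

Definition ham a b := \sum_(i < n) (a i != b i).
Definition flip i a : cube n := [ffun j => a j (+) (j == i)].
Definition btw a b z := forall i, a i = b i -> z i = a i.

Lemma flipE i a j : flip i a j = a j (+) (j == i).
Proof. by rewrite ffunE. Qed.

Lemma flipK i : involutive (flip i).
Proof. by move=> a; apply/ffunP => j; rewrite !flipE addbK. Qed.

Lemma flipC i j a : flip i (flip j a) = flip j (flip i a).
Proof. by apply/ffunP => l; rewrite !flipE addbAC. Qed.

Lemma flip_inj a : injective (fun i => flip i a).
Proof.
move=> i j /ffunP/(_ i); rewrite !flipE eqxx.
by case: eqP => // _; case: (a i).
Qed.

Lemma ham_card a b : ham a b = #|[set i | a i != b i]|.
Proof. by rewrite /ham -big_mkcond /= sum1dep_card. Qed.

Lemma hamC a b : ham a b = ham b a.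
Proof. by apply: eq_bigr => i _; rewrite eq_sym. Qed.

Lemma hamxx a : ham a a = 0.
Proof. by apply: big1 => i _; rewrite eqxx. Qed.

Lemma ham_eq0 a b : (ham a b == 0) = (a == b).
Proof.
apply/idP/eqP => [|->]; last by rewrite hamxx.
rewrite sum_nat_eq0 => /forallP h; apply/ffunP => i.
by move: (h i); case: (a i) (b i) => [] [].
Qed.

Lemma ham_triangle a b c : ham a c <= ham a b + ham b c.
Proof.
rewrite -big_split /=; apply: leq_sum => i _.
by case: (a i) (b i) (c i) => [] [] [].
Qed.

Lemma ham_btw a b z : btw a b z -> ham a z + ham z b = ham a b.
Proof.
move=> h; rewrite -big_split /=; apply: eq_bigr => i _.
by move: (h i); case: (a i) (b i) (z i) => [] [] [] //= /(_ erefl).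
Qed.

(** A coordinate where [a] and [b] agree but [z] does not adds 2 to the left side and 0 to the
    right; every other coordinate obeys the triangle inequality. *)
Lemma btw_ham a b z : ham a z + ham z b <= ham a b -> btw a b z.
Proof.
move=> h i eab; apply/eqP/negPn/negP => ne.
suff: ham a b < ham a z + ham z b by rewrite ltnNge h.
rewrite -big_split /= /ham (bigD1 i) //= [X in _ < X](bigD1 i) //=.
rewrite -eab eqxx (eq_sym (a i)) ne add0n -addnA add1n ltnS addnC.
apply: leq_trans (leq_addr _ _); apply: leq_sum => j _.
by case: (a j) (b j) (z j) => [] [] [].
Qed.

Lemma btw_sym a b z : btw a b z -> btw b a z.
Proof. by move=> h i e; rewrite h -?e. Qed.

Lemma btw_flip i a b z : a i != b i -> btw (flip i a) b z -> btw a b z.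
Proof.
move=> ne h j eab; have := h j; rewrite flipE.
by case: (eqVneq j i) ne => [<-|_ _]; rewrite eab ?eqxx //= addbF => ->.
Qed.

Lemma ham_flip i a b : a i != b i -> ham a b = (ham (flip i a) b).+1.
Proof.
move=> ne; rewrite /ham (bigD1 i) //= [in RHS](bigD1 i) //= ne flipE eqxx.
have -> : (a i (+) true != b i) = false by move: ne; case: (a i) (b i) => [] [].
rewrite add0n add1n; congr _.+1; apply: eq_bigr => j /negPf ji.
by rewrite flipE ji addbF.
Qed.

Lemma ham_flip1 i a : ham a (flip i a) = 1.
Proof. by rewrite (@ham_flip i) ?hamxx // flipE eqxx; case: (a i). Qed.

Lemma ham_flip2 i a b : ham (flip i a) (flip i b) = ham a b.
Proof.
apply: eq_bigr => j _; rewrite !flipE.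
by case: (a j) (b j) (j == i) => [] [] [].
Qed.

Lemma ham_flip_flip i j a : i != j -> ham a (flip j (flip i a)) = 2.
Proof.
move=> ij; rewrite (@ham_flip j) ?ham_flip2 ?ham_flip1 //.
by rewrite !flipE eqxx (eq_sym j) (negPf ij) addbF; case: (a j).
Qed.

Lemma ham1P a b : ham a b = 1 -> exists i, a i != b i /\ b = flip i a.
Proof.
move=> h; have [i ne|e] := pickP (fun i => a i != b i).
  exists i; split=> //; apply/eqP; rewrite eq_sym -ham_eq0.
  by move/eqP: h; rewrite (ham_flip ne).
suff : ham a b = 0 by rewrite h.
by apply: big1 => i _; rewrite e.
Qed.

Lemma QadjE a b : Qadj a b = (ham a b == 1).
Proof. by rewrite /Qadj ham_card. Qed.

Lemma ham_walk a b k : walk (@Qadj n) a b k -> ham a b <= k.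
Proof.
case=> p [<- + <-]; elim: p a => [|c p IH] a /=; first by rewrite hamxx.
case/andP; rewrite QadjE => /eqP h /IH le.
by apply: leq_trans (ham_triangle a c _) _; rewrite h add1n ltnS.
Qed.

Lemma walk_ham a b : walk (@Qadj n) a b (ham a b).
Proof.
move: {2}(ham a b) (erefl (ham a b)) => k; elim: k a => [|k IH] a hk.
  by exists [::]; split; rewrite ?hk //; apply/eqP; rewrite -ham_eq0 hk.
have [i ne|e] := pickP (fun i => a i != b i); last first.
  suff : ham a b = 0 by rewrite hk.
  by apply: big1 => i _; rewrite e.
have hk' : ham (flip i a) b = k by move: hk; rewrite (ham_flip ne); case.
have [p [sp pp lp]] := IH _ hk'.
by exists (flip i a :: p); split=> //=; rewrite ?sp ?hk ?hk' // QadjE ham_flip1 pp.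
Qed.

Lemma dist_ham a b d : dist (@Qadj n) a b d <-> d = ham a b.
Proof.
split=> [[w m]|->]; last by split; [exact: walk_ham | exact: ham_walk].
by apply/eqP; rewrite eqn_leq (ham_walk w) (m _ (walk_ham a b)).
Qed.

End Hamming.

(** * Isometric vertex sets of the hypercube *)

(** Only the first step of a geodesic is required; iteration yields a whole geodesic inside [S]. *)
Definition isometric n (S : {set cube n}) := forall a b, a \in S -> b \in S ->
  a != b -> exists2 i, a i != b i & flip i a \in S.

Definition betweenness_closed n (S : {set cube n}) := forall i a c,
  a \in S -> flip i a \in S -> c \in S -> flip i c \in S -> a i = c i ->
  1 < ham a c ->
  exists x, [/\ x \in S, flip i x \in S, btw a c x, x != a & x != c].

Section Isometric.
Variables (n : nat) (S : {set cube n}).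
Hypothesis isoS : isometric S.
Implicit Types (a b c x z : cube n) (i j : 'I_n).

(** A geodesic inside [S] from [a] to [b] flips coordinate [i] once; [x] is the vertex just before
    that flip. *)
Lemma crossing i a b : a \in S -> b \in S -> a i != b i ->
  exists x, [/\ x \in S, flip i x \in S, btw a b x & x i = a i].
Proof.
move: {2}(ham a b) (erefl (ham a b)) => k; elim: k a => [|k IH] a hk aS bS ne.
  by move/eqP: hk ne; rewrite ham_eq0 => /eqP ->; rewrite eqxx.
have [|j nej jS] := isoS aS bS; first by apply: contraNneq ne => ->.
have [<-|ji] := eqVneq j i; first by exists a.
have hk' : ham (flip j a) b = k by move: hk; rewrite (ham_flip nej); case.
have fi : flip j a i = a i by rewrite flipE eq_sym (negPf ji) addbF.
have [//||x [xS xiS hx xi]] := IH _ hk' jS; rewrite ?fi //.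
by exists x; split=> //; [exact: btw_flip hx | rewrite xi fi].
Qed.

Lemma between_at t a b : a \in S -> b \in S -> t <= ham a b ->
  exists x, [/\ x \in S, btw a b x & ham a x = t].
Proof.
elim: t => [|t IH] aS bS; first by exists a; rewrite hamxx; split.
move=> lt; have [x [xS hx xt]] := IH aS bS (ltnW lt).
have xb : x != b by apply: contraTneq lt => <-; rewrite xt ltnn.
have [j nej jS] := isoS xS bS xb; exists (flip j x).
have := ham_btw hx; rewrite (ham_flip nej) xt => e.
have le : ham a (flip j x) <= t.+1.
  by apply: leq_trans (ham_triangle _ x _) _; rewrite ham_flip1 xt addn1.
have ge := ham_triangle a (flip j x) b.
split=> //; last by apply/eqP; rewrite eqn_leq le /=; lia.
by apply: btw_ham; lia.
Qed.

End Isometric.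

(** * Zones of parallel edges and straight paths *)

Section Straight.
Variables (n : nat) (S : {set cube n}).
Hypothesis btwS : betweenness_closed S.
Implicit Types (a b c x z : cube n) (i j : 'I_n).

(* The endpoints of the edges of direction [i], on one of their two sides, form
   an isometric subgraph. *)
Lemma zone_step i a c : a \in S -> flip i a \in S -> c \in S -> flip i c \in S ->
  a i = c i -> a != c ->
  exists j, [/\ a j != c j, flip j a \in S & flip i (flip j a) \in S].
Proof.
move: {2}(ham a c) (leqnn (ham a c)) => k; elim: k c => [|k IH] c hk.
  by move: hk; rewrite leqn0 ham_eq0 => ->.
move=> aS aiS cS ciS ei ac; have [h|h] := leqP (ham a c) 1.
  have /ham1P[j [nej ej]] : ham a c = 1.
    by apply/eqP; rewrite eqn_leq h lt0n ham_eq0.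
  by exists j; rewrite -ej.
(* Since [x] lies strictly between, it is nearer to [a], and a step towards [x] is also a step
   towards [c]. *)
have [x [xS xiS hx xa xc]] := btwS aS aiS cS ciS ei h.
have := ham_btw hx; have : 0 < ham x c by rewrite lt0n ham_eq0.
move=> h1 h2; have le : ham a x <= k by lia.
have [//||j [nej jS jiS]] := IH x le aS aiS xS xiS; rewrite 1?eq_sym ?hx //.
by exists j; split=> //; apply: contraNneq nej => /hx->.
Qed.

Section StraightPath.
Variables (a : nat -> cube n) (c : nat -> 'I_n).
Hypothesis aS : forall t, a t \in S.
Hypothesis aD : forall t, a t.+1 = flip (c t) (a t).
Hypothesis cD : forall t, c t.+1 != c t.
(** The excluded vertex is the fourth corner of the square spanned by the two path edges at
    [a t.+1]. *)
Hypothesis cS : forall t, flip (c t.+1) (a t) \notin S.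

(** For the segment of [m] edges from [a s]: [geo] makes it a geodesic, and with [first] every
    geodesic in [S] to its end starts with the edge [c s]. *)
Let geo m s := forall t t', t < t' < m -> c (s + t) != c (s + t').
Let first m s := forall t, t < m -> flip (c (s + t)) (a s) \in S -> t = 0.

Let no_square t : flip (c t) (a t.+2) \notin S.
Proof. by rewrite !aD flipC flipK cS. Qed.


Let coord m s j : (forall t, t < m -> c (s + t) != j) -> a (s + m) j = a s j.
Proof.
elim: m => [|m IH] h; first by rewrite addn0.
rewrite addnS aD flipE IH => [|t lt]; last by apply: h; rewrite ltnS ltnW.
by rewrite eq_sym (negPf (h m _)) // addbF.
Qed.

(** A step from [a s] towards [a (s + m)] inside the zone of [i] has a direction used by the
    segment, so by [first] it is the edge [c s] of the path. The next vertex is thus in the zone,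
    and induction applies. *)
Let zone_segment m s i :
  (forall t l, t + l <= m -> geo l (s + t) /\ first l (s + t)) ->
  flip i (a s) \in S -> flip i (a (s + m)) \in S ->
  (forall t, t < m -> c (s + t) != i) ->
  forall t, t <= m -> flip i (a (s + t)) \in S.
Proof.
elim: m s => [|m IH] s H h1 h2 ci t; first by rewrite leqn0 => /eqP ->.
have [g f] := H 0 m.+1 (leqnn _); rewrite addn0 in g f.
have e0 : a (s + m.+1) (c s) != a s (c s).
  rewrite -addSnnS coord ?aD ?flipE ?eqxx; first by case: (a s _).
  move=> u um; rewrite addSnnS eq_sym.
  by have := g 0 u.+1; rewrite addn0 ltnS; apply.
have [j [nej jS jiS]] : exists j, [/\ a s j != a (s + m.+1) j,
    flip j (a s) \in S & flip i (flip j (a s)) \in S].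
  apply: zone_step => //; first by rewrite coord.
  by apply: contraNneq e0 => <-.
have [u um cu] : exists2 u, u < m.+1 & c (s + u) = j.
  have [[u um] /= /eqP e|no] := pickP (fun u : 'I_m.+1 => c (s + u) == j).
    by exists u.
  by rewrite coord ?eqxx // in nej => u um; rewrite (no (Ordinal um)).
rewrite -cu in jS jiS; have u0 := f _ um jS.
rewrite u0 addn0 -aD in jiS.
case: t => [|t] tm; first by rewrite addn0.
rewrite -addSnnS; apply: IH => //; rewrite ?addSnnS //.
  by move=> v l vl; rewrite addSnnS; apply: H.
by move=> v vm; rewrite addSnnS; apply: ci.
Qed.

(* A repeated direction, or a second way of starting a geodesic, puts a whole
   segment into one zone, which closes a corner of the path into a square. *)
Lemma straight_geodesic m s : geo m s /\ first m s.
Proof.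
elim/ltn_ind: m s => m IH s.
have G : geo m s.
  move=> t t' /andP[tt t'm]; apply/eqP => e.
  (* A repetition inside a shorter segment is excluded by induction; otherwise it is between the
     first and the last edge. *)
  have [small|big] := ltnP (t' - t).+1 m.
    have [g _] := IH _ small (s + t); have := g 0 (t' - t).
    by rewrite addn0 -addnA subnKC ?(ltnW tt) // e eqxx subn_gt0 tt ltnSn => /(_ isT).
  have t0 : t = 0 by lia.
  have [m2|m2] := leqP m 2.
    have t1 : t' = 1 by lia.
    by have := cD s; rewrite t0 t1 addn0 addn1 in e; rewrite e eqxx.
  have em : t' = (m - 3).+2 by lia.
  (* Edges of direction [c s] occur at [a s.+1], where the path has just used one, and at
     [a (s + t')], where it uses one next; so the segment between lies in one zone. *)
  suff : flip (c s) (a (s.+1 + 1)) \in S by rewrite addn1 (negPf (no_square s)).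
  apply: (@zone_segment (m - 3).+1) => [t2 l le|||u um|//].
  - by apply: IH; lia.
  - by rewrite aD flipK.
  - by rewrite t0 em addn0 in e; rewrite e addSnnS -aD.
  - have mm : m.-1 < m by lia.
    have [g _] := IH _ mm s; have := g 0 u.+1.
    by rewrite addn0 addSnnS eq_sym; apply; lia.
split=> // t tm fS; apply/eqP; rewrite -leqn0 leqNgt; apply/negP => t0.
(* Direction [c (s + t)] is available at [a s] by assumption and at [a (s + t)] by the path, hence
   also one step before [a (s + t)]. *)
suff : flip (c (s + t)) (a (s + t.-1)) \in S.
  by have := cS (s + t.-1); rewrite -addnS prednK // => /negPf ->.
apply: (@zone_segment t) => [t2 l le|//||u um|].
- by apply: IH; lia.
- by rewrite -aD.
- by apply: G; rewrite um.
- by rewrite leq_pred.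
Qed.

End StraightPath.

Definition corner (w : cube n * 'I_n * 'I_n) := let: (a, i, j) := w in
  [&& a \in S, flip i a \in S, flip j a \in S, i != j & flip i (flip j a) \notin S].

(** Walks along [j] and pairs the edge just used with a new edge at its far end; the default [j]
    only makes the function total. *)
Definition turn (w : cube n * 'I_n * 'I_n) := let: (a, i, j) := w in
  (flip j a, j, odflt j [pick l | corner (flip j a, j, l)]).

(** If no new corner exists, every direction available at [flip j a] is available at [a]. Equal
    degrees make the two sets equal, yet [i] is available at [a] only. *)
Lemma corner_turn r w :
  (forall a, a \in S -> #|[set i | flip i a \in S]| = r) ->
  corner w -> corner (turn w).
Proof.
case: w => [[a i] j] reg; rewrite {1}/corner /turn.
case/and5P=> aS aiS ajS ij nS; case: pickP => [l //|no].
suff /subset_leqif_cards[_] : [set l | flip l (flip j a) \in S] \subset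
    [set l | flip l a \in S].
  by rewrite !reg // eqxx => /esym/eqP/setP/(_ i); rewrite !inE aiS (negPf nS).
apply/subsetP => l; rewrite !inE => lS; apply/negPn/negP => lN.
have := no l; rewrite /corner ajS flipK aS lS flipC flipK lN andbT /= => /negbFE/eqP jl.
by rewrite -jl ajS in lN.
Qed.

(* In a regular graph a corner that is not in a square can be prolonged forever
   to a straight path, whose directions are pairwise distinct. *)
Lemma regular_square r a i j :
  (forall a, a \in S -> #|[set i | flip i a \in S]| = r) ->
  a \in S -> flip i a \in S -> flip j a \in S -> i != j ->
  flip i (flip j a) \in S.
Proof.
move=> reg aS iS jS ij; apply/negPn/negP => nS.
pose x t := iter t turn (a, i, j).
have xC t : corner (x t).
  elim: t => [|t]; first by rewrite /= aS iS jS ij.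
  exact: corner_turn reg.
(* The first [n.+1] directions would be distinct, but there are only [n] directions. *)
have inj : injective (fun t : 'I_n.+1 => (x t).2).
  have geo t t' : t < t' < n.+1 -> (x t).2 != (x t').2.
    have [] := @straight_geodesic (fun t => (x t).1.1) (fun t => (x t).2) _ _ _ _ n.+1 0.
    - by move=> u; have := xC u; case: (x u) => [[b k] l] /and5P[].
    - by move=> u; rewrite /x /=; case: (iter u turn _) => [[b k] l].
    - move=> u; have := xC u.+1; rewrite /x /=.
      by case: (iter u turn _) => [[b k] l] /= /and5P[_ _ _ + _]; rewrite eq_sym.
    - move=> u; have := xC u.+1; rewrite /x /=.
      case: (iter u turn _) => [[b k] l] /= /and5P[_ _ _ _].
      by rewrite flipC flipC [flip l (flip _ _)]flipC flipK.
    - by move=> g _; exact: g.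
  move=> t t' /eqP e; apply: val_inj; have [lt|gt|//] := ltngtP t t'.
    by have := geo t t'; rewrite lt ltn_ord e => /(_ isT).
  by have := geo t' t; rewrite gt ltn_ord eq_sym e => /(_ isT).
by have := leq_card _ inj; rewrite !card_ord ltnn.
Qed.

End Straight.

(** * Antipodes in a subcube *)

(* For [z] in the subcube spanned by [a] and [b], the vertex of that subcube
   opposite to [z]. *)
Definition antipode n (a b z : cube n) : cube n :=
  [ffun j => z j (+) (a j != b j)].

Lemma antipodeE n (a b z : cube n) j : antipode a b z j = z j (+) (a j != b j).
Proof. by rewrite ffunE. Qed.

Lemma antipodeK n (a b : cube n) : involutive (antipode a b).
Proof. by move=> z; apply/ffunP => j; rewrite !antipodeE addbK. Qed.

Lemma ham_antipode2 n (a b x y : cube n) :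
  ham (antipode a b x) (antipode a b y) = ham x y.
Proof.
apply: eq_bigr => j _; rewrite !antipodeE.
by case: (x j) (y j) (a j != b j) => [] [] [].
Qed.

Lemma btw_antipode n (a b z : cube n) : btw a b z -> btw a b (antipode a b z).
Proof. by move=> h j e; rewrite antipodeE e eqxx addbF h. Qed.

Lemma ham_antipode n (a b x y : cube n) : btw a b x -> btw a b y ->
  ham x (antipode a b y) + ham x y = ham a b.
Proof.
move=> hx hy; rewrite -big_split /=; apply: eq_bigr => j _; rewrite antipodeE.
move: (hx j) (hy j).
by case: (x j) (y j) (a j) (b j) => [] [] [] [] //= /(_ erefl) // _ /(_ erefl).
Qed.

(** The distances from [y] to [x] and to the antipode of [x] sum to [ham a b], so the latter
    distance vanishes. *)
Lemma antipode_uniq n (a b x y : cube n) : btw a b x -> btw a b y ->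
  ham a b <= ham x y -> y = antipode a b x.
Proof.
move=> hx hy le; apply/eqP; rewrite eq_sym -ham_eq0 hamC.
by have := ham_antipode hy hx; rewrite (hamC y x); lia.
Qed.

Lemma btw_trans n (a b x y z : cube n) :
  btw a b x -> btw a b y -> btw x y z -> btw a b z.
Proof. by move=> hx hy hz j e; rewrite hz ?hx ?hy. Qed.

Lemma cycle_adj_nth (T : finType) (x0 : T) (c : seq T) s t : uniq c ->
  s < t < size c -> t = s.+1 \/ s = 0 /\ t.+1 = size c ->
  cycle_adj c (nth x0 c s) (nth x0 c t).
Proof.
move=> uc /andP[st tc]; have sc := ltn_trans st tc.
(* With the head of [c] as default value, the index past the end wraps around to the first
   vertex. *)
have next_at k : k < size c -> next c (nth x0 c k) = nth (nth x0 c 0) c k.+1.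
  by move=> kc; rewrite next_nth mem_nth // index_uniq //; case: (c) kc.
rewrite /cycle_adj !mem_nth //= !next_at //.
case=> [<-|[-> et]]; first by rewrite (set_nth_default x0) ?eqxx.
by rewrite et [X in _ || (X == _)]nth_default // eqxx orbT.
Qed.

(** * Convex cycles spanned by intervals of a partial cube *)

Section Graph.
Variables (T : finType) (e : rel T) (n : nat) (f : T -> cube n).
Hypothesis e_sym : symmetric e.
Hypothesis e_irr : irreflexive e.
Hypothesis f_dist : forall u v, dist e u v (ham (f u) (f v)).

Definition image_set : {set cube n} := [set f u | u : T].

Lemma dist_unique u v d : dist e u v d -> d = ham (f u) (f v).
Proof.
case: (f_dist u v) => w m [w' m']; apply/eqP.
by rewrite eqn_leq m // m'.
Qed.

Lemma f_inj : injective f.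
Proof.
move=> u v h; case: (f_dist u v) => -[p [sp _ <-]] _.
by rewrite h hamxx in sp; rewrite (size0nil sp).
Qed.

Lemma adjE u v : e u v = (ham (f u) (f v) == 1).
Proof.
case: (f_dist u v) => -[p [sp pp lp]] m; apply/idP/eqP => [uv|h].
  apply/eqP; rewrite eqn_leq m; last by exists [:: v]; rewrite /= uv.
  by rewrite lt0n ham_eq0; apply: contraTneq uv => /f_inj->; rewrite e_irr.
by case: p sp pp lp => [|w [|//]] /=; rewrite h //= andbT => _ uw <-.
Qed.

Lemma ham_path u p : path e u p -> ham (f u) (f (last u p)) <= size p.
Proof. by move=> pp; case: (f_dist u (last u p)) => _; apply; exists p. Qed.

Lemma image_isometric : isometric image_set.
Proof.
move=> _ _ /imsetP[u _ ->] /imsetP[v _ ->] ne.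
case: (f_dist u v) => -[p [sp pp lp]] _; case: p sp pp lp => [|w p] /=.
  by move/esym/eqP; rewrite ham_eq0 (negPf ne).
move=> sp /andP[uw pp] lp.
move: uw; rewrite adjE => /eqP/ham1P[i [_ fw]].
have := ham_path pp; rewrite lp fw => le.
exists i; last by rewrite -fw imset_f.
apply/negP => /eqP ei.
suff : ham (f u) (f v) < ham (flip i (f u)) (f v) by lia.
by rewrite [X in _ < X](@ham_flip _ i) ?flipK // flipE eqxx ei; case: (f v i).
Qed.

Lemma geodesic_btw u v p x : path e u p -> last u p = v ->
  size p = ham (f u) (f v) -> x \in u :: p -> btw (f u) (f v) (f x).
Proof.
move=> pp <- sp xp; apply: btw_ham; rewrite -sp.
case/splitPl: xp pp => p1 p2 <-; rewrite cat_path last_cat size_cat => /andP[h1 h2].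
exact: leq_add (ham_path h1) (ham_path h2).
Qed.


(** Geodesics between vertices of an interval stay in it, hence in [c]; as [c] has no chords, they
    run along its edges. This gives isometry and convexity at once. *)
Lemma interval_cycle_convex (c : seq T) a b :
  is_cycle e c ->
  (forall z, (z \in c) <-> btw a b (f z)) ->
  {in c &, forall x y, e x y -> cycle_adj c x y} ->
  convex_cycle e c.
Proof.
move=> cyc mem adj.
have path_adj u p : {subset u :: p <= c} -> path e u p -> path (cycle_adj c) u p.
  elim: p u => [//|w p IH] u sub /= /andP[uw pp]; apply/andP; split.
    by apply: adj => //; apply: sub; rewrite !inE eqxx ?orbT.
  by apply: IH => // z zp; apply: sub; rewrite inE zp orbT.
have adj_path u p : path (cycle_adj c) u p -> path e u p.
  case: cyc => _ _ cyc; apply: sub_path => x y /and3P[xc yc].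
  by case/orP=> /eqP <-; [|rewrite e_sym]; apply: next_cycle.
have geo u v : u \in c -> v \in c -> forall p, size p = ham (f u) (f v) ->
    path e u p -> last u p = v -> path (cycle_adj c) u p.
  move=> uc vc p sp pp lp; apply: path_adj => // x xp; apply/mem.
  apply: btw_trans (geodesic_btw pp lp sp xp); exact/mem.
have geo_dist u v : u \in c -> v \in c -> dist (cycle_adj c) u v (ham (f u) (f v)).
  move=> uc vc; case: (f_dist u v) => -[p [sp pp lp]] m; split.
    by exists p; split=> //; apply: (geo u v).
  by move=> k [q [sq pq lq]]; apply: m; exists q; split=> //; apply: adj_path.
split=> //; split=> u v uc vc d.
  split=> [/dist_unique->|[w m]]; first exact: geo_dist.
  suff -> : d = ham (f u) (f v) by [].
  have [w' m'] := geo_dist u v uc vc.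
  by apply/eqP; rewrite eqn_leq m // m'.
by move=> /dist_unique-> p; apply: (geo u v).
Qed.

Lemma ham_nth u p s t : path e u p -> s <= t <= size p ->
  ham (f (nth u (u :: p) s)) (f (nth u (u :: p) t)) <= t - s.
Proof.
move=> /(pathP u) pp; elim: t => [|t IH]; first by rewrite leqn0 => /andP[/eqP->]; rewrite hamxx.
rewrite leq_eqVlt => /andP[/predU1P[->|st] tp]; first by rewrite hamxx.
apply: leq_trans (ham_triangle _ (f (nth u (u :: p) t)) _) _.
move: (pp t tp); rewrite adjE => /eqP /= ->.
by rewrite addn1 subSn // ltnS IH // -ltnS st ltnW.
Qed.

Lemma geodesic_nth u p s : path e u p -> ham (f u) (f (last u p)) = size p ->
  s <= size p -> ham (f u) (f (nth u (u :: p) s)) = s.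
Proof.
move=> pp hp sk; apply/eqP; rewrite eqn_leq.
have := @ham_nth u p 0 s pp; rewrite sk subn0 => -> //.
have := @ham_nth u p s (size p) pp; rewrite sk leqnn => /(_ isT).
rewrite [nth u (u :: p) (size p)]nth_last [last _ (u :: p)]/=.
have := ham_triangle (f u) (f (nth u (u :: p) s)) (f (last u p)).
by rewrite hp; lia.
Qed.

(** A geodesic with [k] edges followed by its antipodes closes up into a chordless cycle of length
    [2 * (k + 1)]. *)
Lemma antipodal_cycle a d p (A : T -> T) :
  path e a p -> 0 < size p -> ham (f a) (f (last a p)) = size p ->
  ham (f a) (f d) = (size p).+1 -> btw (f a) (f d) (f (last a p)) ->
  {in a :: p, forall x, f (A x) = antipode (f a) (f d) (f x)} ->
  let c := (a :: p) ++ map A (a :: p) in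
  is_cycle e c /\ {in c &, forall x y, e x y -> cycle_adj c x y}.
Proof.
move=> pp p0 hp had hc fA; set k := size p in p0 hp had; set P := a :: p.
set Q := map A P; move=> c.
have Pbtw x : x \in P -> btw (f a) (f d) (f x).
  by move=> xP; apply: btw_trans (geodesic_btw pp erefl (esym hp) xP).
have hamA x y : x \in P -> y \in P -> ham (f x) (f (A y)) + ham (f x) (f y) = k.+1.
  by move=> xP yP; rewrite fA // ham_antipode ?had //; apply: Pbtw.
have hamAA x y : x \in P -> y \in P -> ham (f (A x)) (f (A y)) = ham (f x) (f y).
  by move=> xP yP; rewrite !fA // ham_antipode2.
have PI s : s <= k -> nth a P s \in P by move=> sk; rewrite mem_nth.
have ham0 s : s <= k -> ham (f a) (f (nth a P s)) = s by exact: geodesic_nth.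
have hamP s t : s <= k -> t <= k -> ham (f (nth a P s)) (f (nth a P t)) <= (t - s) + (s - t).
  move=> sk tk; have [st|ts] := leqP s t.
    by have := @ham_nth a p s t pp; rewrite -/P st tk => /(_ isT); lia.
  by have := @ham_nth a p t s pp; rewrite -/P ltnW // sk hamC => /(_ isT); lia.
have uP : uniq P.
  apply/(uniqP a) => s t; rewrite !inE => sk tk e0.
  by rewrite -(ham0 s) // e0 ham0.
have AP x y : x \in P -> y \in P -> A x != y.
  move=> /(nthP a)[s sk <-] /(nthP a)[t tk <-]; apply/eqP => e0.
  have := hamA _ _ (PI t tk) (PI s sk); rewrite e0 hamxx; have := hamP t s tk sk.
  rewrite /= in sk tk; lia.
have uc : uniq c.
  rewrite /c -/P -/Q cat_uniq uP andTb; apply/andP; split.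
    by apply/hasPn => x /mapP[y yP ->]; apply/negP => xP; have := AP _ _ yP xP; rewrite eqxx.
  rewrite map_inj_in_uniq // => x y xP yP /(congr1 f) e0.
  by apply: f_inj; apply/eqP; rewrite -ham_eq0 -hamAA // e0 hamxx.
have sizec : size c = k.+1 + k.+1 by rewrite size_cat size_map.
have stepE s t : s < t < size c -> e (nth a c s) (nth a c t) ->
    t = s.+1 \/ s = 0 /\ t.+1 = size c.
  rewrite sizec adjE => /andP[st tc] /eqP; rewrite !nth_cat /= -/k.
  have nA u : u <= k -> nth a Q u = A (nth a P u) by move=> uk; rewrite (nth_map a).
  case: (ltnP s k.+1) => sk; case: (ltnP t k.+1) => tk; try lia.
  - move=> e0; left; have := ham_triangle (f a) (f (nth a P s)) (f (nth a P t)).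
    by rewrite e0 !ham0 //; lia.
  (* A vertex of [P] is adjacent to an antipode only if the two ranks differ by [k], that is, at the
     two junctions of the cycle. *)
  - have tk' : t - k.+1 <= k by lia.
    rewrite -/P -/Q nA // => e0; have := hamA _ _ (PI s sk) (PI _ tk'); rewrite e0.
    by have := hamP s _ sk tk'; lia.
  have sk' : s - k.+1 <= k by lia.
  have tk' : t - k.+1 <= k by lia.
  rewrite -/Q !nA // hamAA ?PI // => e0.
  have := ham_triangle (f a) (f (nth a P (s - k.+1))) (f (nth a P (t - k.+1))).
  by rewrite e0 !ham0 //; lia.
split; last first.
  move=> x y /(nthP a)[s sc <-] /(nthP a)[t tc <-] xy.
  have [st|ts|e0] := ltngtP s t.
  - by apply: cycle_adj_nth => //; [rewrite st | apply: stepE; rewrite ?st].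
  - have := @cycle_adj_nth _ a c t s uc; rewrite ts sc => /(_ isT).
    rewrite /cycle_adj andbCA orbC; apply; apply: stepE; rewrite ?ts // e_sym //.
  by rewrite e0 e_irr in xy.
split=> //; first by rewrite sizec; lia.
have aP : a \in P by rewrite mem_head.
have lP : last a p \in P by rewrite mem_last.
have /eqP := hamA _ _ lP aP.
rewrite [ham _ (f a)]hamC hp -[k.+1]add1n eqn_add2r => /eqP end1.
have /eqP := hamA _ _ aP lP; rewrite hp -[k.+1]add1n eqn_add2r hamC => /eqP end2.
rewrite /c /= rcons_path cat_path pp /= last_cat /= last_map !adjE end1 end2 /= andbT.
rewrite path_map; apply: (@sub_in_path _ (mem P)) pp; last exact/allP.
by move=> x y xP yP /=; rewrite !adjE hamAA.
Qed.

(** * Betweenness closure from convex 4-cycles *)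

Hypothesis convex4 : forall c, convex_cycle e c -> size c = 4.

Let S : {set cube n} := image_set.

(** Without a vertex strictly between, a geodesic from [a] to [c] and its antipodes fill the
    interval of [a] and [d] in [S], which is then a convex cycle of length [2 * (k + 1) > 4]. *)
Lemma image_betweenness_closed : betweenness_closed S.
Proof.
move=> i _ _ /imsetP[a _ ->] /imsetP[b _ eb] /imsetP[c _ ->] /imsetP[d _ ed] ei k2.
set k := ham (f a) (f c) in k2.
have [x /and5P[xS xiS hx xa xc]|no] := pickP (fun x : cube n => [&& x \in S, flip i x \in S,
    [forall j, (f a j == f c j) ==> (x j == f a j)], x != f a & x != f c]).
  exists x; split=> // j e0; apply/eqP.
  by move/forallP: hx => /(_ j); rewrite e0 eqxx.
have isoS := image_isometric.
have {}no (x : cube n) : x \in S -> flip i x \in S -> btw (f a) (f c) x -> x = f a \/ x = f c.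
  move=> xS xiS hx; have := no x; rewrite xS xiS.
  have -> : [forall j, (f a j == f c j) ==> (x j == f a j)].
    by apply/forallP => j; apply/implyP => /eqP e0; rewrite hx.
  by case: eqP => [|_]; [left | case: eqP => [|_]; [right|]].
have di : f a i != f d i by rewrite -ed flipE eqxx ei; case: (f c i).
have had : ham (f a) (f d) = k.+1.
  by rewrite hamC (@ham_flip _ i) 1?eq_sym // -ed flipK hamC.
have hbd : ham (f b) (f d) = k by rewrite -eb -ed ham_flip2.
pose A := antipode (f a) (f d).
have side (z : cube n) : btw (f a) (f d) z -> z i = f a i -> btw (f a) (f c) z.
  move=> hz zi j e0; have [->//|ji] := eqVneq j i.
  by apply: hz; rewrite -ed flipE (negPf ji) addbF.
have dac (z : cube n) : btw (f a) (f c) z -> btw (f a) (f d) z.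
  move=> hz j; rewrite -ed flipE; have [->|_] := eqVneq j i; first by rewrite hz.
  by rewrite addbF; apply: hz.
(* The only edges of direction [i] in the interval of [a] and [d] being [ab] and
   [cd], a geodesic between the two sides passes through one of these. *)
have anti (z w : cube n) : z \in S -> w \in S -> btw (f a) (f c) z -> btw (f b) (f d) w ->
    ham (f a) z + ham (f b) w = k -> w = A z.
  move=> zS wS hz hw e1.
  have wi : w i = f d i by rewrite (btw_sym hw) // -eb -ed !flipE ei.
  have zi : z i = f a i by rewrite hz.
  have hw' : btw (f a) (f d) w.
    move=> j e0; have ji : j != i by apply: contraNneq di => <-; rewrite e0.
    by rewrite hw -eb ?flipE ?(negPf ji) ?addbF // -ed !flipE (negPf ji)
      !addbF -e0 -ed flipE (negPf ji) addbF.
  apply: antipode_uniq => //; first exact: dac.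
  have [|x [xS xiS hx xi]] := @crossing _ _ isoS i z w zS wS; first by rewrite zi wi.
  have xac : btw (f a) (f c) x.
    by apply: side; [apply: btw_trans hx => //; apply: dac | rewrite xi zi].
  have := ham_btw hx; have := ham_btw hz; have := ham_btw hw.
  have flipw (y : cube n) : y i != w i -> ham y w = (ham (flip i y) w).+1 by exact: ham_flip.
  rewrite had hbd -/k; case: (no x xS xiS xac) => ->.
    by rewrite (flipw (f a)) ?wi // eb (hamC z (f a)); lia.
  rewrite (flipw (f c)) ?wi -?ei // ed (hamC (f d) w); lia.
have SI u : f u \in S by rewrite imset_f.
have aS := SI a; have bS := SI b; have cS := SI c; have dS := SI d.
(* The vertex of complementary rank on a geodesic from [b] to [d] must be the antipode, which
   therefore lies in [S]. *)
have partner (z : cube n) : z \in S -> btw (f a) (f c) z ->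
    [/\ A z \in S, btw (f b) (f d) (A z) & ham (f a) z + ham (f b) (A z) = k].
  move=> zS hz; have le : ham (f a) z <= k by rewrite -[k](ham_btw hz) leq_addr.
  have [|w [wS hw e1]] := @between_at _ _ isoS (k - ham (f a) z) _ _ bS dS.
    by rewrite hbd leq_subr.
  have e2 : ham (f a) z + ham (f b) w = k by rewrite e1 subnKC.
  by rewrite -(anti z w).
pose AT u := odflt u [pick v | f v == A (f u)].
have fAT u : btw (f a) (f c) (f u) -> f (AT u) = A (f u).
  move=> hu; rewrite /AT; case: pickP => [v /eqP //|no'].
  by have [/imsetP[v _ ev] _ _] := partner _ (SI u) hu; have := no' v; rewrite ev eqxx.
case: (f_dist a c) => -[p [sp pp lp]] _.
have pbtw x : x \in a :: p -> btw (f a) (f c) (f x) by exact: geodesic_btw.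
have at_rank t : t <= k -> exists2 x, x \in a :: p & ham (f a) (f x) = t.
  move=> tk; exists (nth a (a :: p) t); first by rewrite mem_nth //= sp.
  by apply: geodesic_nth; rewrite ?lp ?sp.
have [||||x xp|cyc adj] := @antipodal_cycle a d p AT pp.
- by rewrite sp -/k; lia.
- by rewrite lp.
- by rewrite sp.
- by rewrite lp; apply: dac => ? ->.
- exact/fAT/pbtw.
set C := (a :: p) ++ map AT (a :: p) in cyc adj.
have /convex4 : convex_cycle e C.
  apply: (@interval_cycle_convex C (f a) (f d)) => // z; split.
    rewrite mem_cat => /orP[/pbtw/dac //|/mapP[x xp ->]].
    by rewrite fAT; [apply: btw_antipode; apply: dac |]; apply: pbtw.
  move=> hz; rewrite mem_cat; have [zi|zi] := eqVneq (f z i) (f a i).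
    have zac := side _ hz zi.
    have [|x xp xr] := at_rank (ham (f a) (f z)); first by rewrite -[k](ham_btw zac) leq_addr.
    suff -> : z = x by rewrite xp.
    have [zS hAz r] := partner _ (SI z) zac.
    apply: f_inj; apply: (can_inj (@antipodeK _ (f a) (f d))).
    by apply: (anti (f x)) => //; [apply: pbtw | rewrite xr].
  have zbd : btw (f b) (f d) (f z).
    move=> j; rewrite -eb -ed !flipE; have [->|ji] := eqVneq j i.
      by move: zi; case: (f z i) (f a i) => [] [].
    by rewrite !addbF => e0; apply: hz; rewrite -ed flipE (negPf ji) addbF.
  have [|x xp xr] := at_rank (k - ham (f b) (f z)); first exact: leq_subr.
  apply/orP; right; apply/mapP; exists x => //; apply: f_inj; rewrite fAT; last exact: pbtw.
  apply: anti => //; [exact: pbtw | rewrite xr subnK //].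
  by rewrite -hbd -(ham_btw zbd) leq_addr.
by rewrite size_cat size_map /= sp -/k; lia.
Qed.

End Graph.

(** * Convex cycles of a hypercube *)

Section Converse.
Variables (T : finType) (e : rel T) (k : nat) (g : T -> cube k).
Hypothesis g_bij : bijective g.
Hypothesis g_adj : forall x y, e x y = Qadj (g x) (g y).

(** Consecutive vertices [x], [y], [z] lie in a square with fourth vertex [w]. By convexity the
    geodesic [x], [w], [z] runs along the cycle, which closes it after four steps. *)
Lemma cube_convex_cycle c : convex_cycle e c -> size c = 4.
Proof.
have [h gK hK] := g_bij.
have step x y : e x y -> exists i, g y = flip i (g x).
  by rewrite g_adj QadjE => /eqP/ham1P[i [_]]; exists i.
case=> -[]; case: c => [|x [|y [|z c]]] // _ uc cyc [_ conv].
have /and3P[xy yz _] := cyc.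
have [[i ei] [j ej]] := (step _ _ xy, step _ _ yz).
have xz : x != z by move: uc; rewrite /= !inE !negb_or -!andbA => /and5P[_ + _ _ _].
have ij : i != j.
  by apply: contraNneq xz => eij; apply/eqP/(can_inj gK); rewrite ej ei eij flipK.
pose w := h (flip j (g x)).
have gw : g w = flip j (g x) by rewrite hK.
have xw : e x w by rewrite g_adj QadjE gw ham_flip1.
have wz : e w z by rewrite g_adj QadjE gw ej ei flipC ham_flip1.
have wy : w != y.
  apply: contraNneq ij => /(congr1 g); rewrite gw ei => /flip_inj->.
  by rewrite eqxx.
have gxz : ham (g x) (g z) = 2.
  by rewrite ej ei ham_flip_flip.
have dxz : dist e x z 2.
  split=> [|d [p [<- pp lp]]]; first by exists [:: w; z]; rewrite /= xw wz.
  rewrite -gxz -lp; apply: ham_walk; exists (map g p).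
  rewrite size_map last_map path_map; split=> //.
  by apply: sub_path pp => u v; rewrite g_adj.
set c' := [:: x, y, z & c] in uc cyc conv *.
have xc : x \in c' by rewrite !inE eqxx.
have zc : z \in c' by rewrite !inE eqxx !orbT.
have /= := conv x z xc zc 2 dxz [:: w; z] erefl.
rewrite xw wz => /(_ isT erefl) /and3P[/and3P[_ wc a1] /and3P[_ _ a2] _].
(* As [x] is followed by [y], the cycle edges at [w] are traversed in the order [z], [w], [x]. *)
have nx : next c' x = y by rewrite /= eqxx.
have nw : next c' w = x.
  by move: a1; rewrite nx eq_sym (negPf wy) => /eqP.
have nz : next c' z = w.
  by move: a2; rewrite nw (negPf xz) => /eqP.
have wx : w != x by apply: contraTneq xw => ->; rewrite g_adj QadjE hamxx.
have next_at k' : k' < size c' -> next c' (nth x c' k') = nth x (behead c') k'.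
  by move=> kc; rewrite next_nth mem_nth // index_uniq.
rewrite /c' in uc next_at nz nw; clear -wx uc next_at nz nw.
case: c => [|v c] in uc next_at nz nw *.
  by move: wx; rewrite -nz (next_at 2) //= eqxx.
have vw : v = w by rewrite -nz (next_at 2).
case: c => [|u c] // in uc next_at nz nw *.
by move: uc; rewrite -nw -vw (next_at 3) //= !inE eqxx !orbT.
Qed.

End Converse.

(** * Square-closed isometric sets are subcubes *)

Section SquareClosed.
Variables (n : nat) (S : {set cube n}).
Hypothesis isoS : isometric S.
Hypothesis sqS : forall a i j, a \in S -> flip i a \in S -> flip j a \in S ->
  i != j -> flip i (flip j a) \in S.

Definition directions (a : cube n) := [set i | flip i a \in S].

Lemma directions_flip a i : a \in S -> flip i a \in S ->
  directions (flip i a) = directions a.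
Proof.
move=> aS iS; apply/setP => j; rewrite !inE.
have [->|ji] := eqVneq j i; first by rewrite flipK aS iS.
apply/idP/idP => [h|jS]; last exact: sqS.
have : flip i (flip j (flip i a)) \in S by apply: sqS; rewrite ?flipK // eq_sym.
by rewrite (flipC j) flipK.
Qed.

Lemma directions_const a b : a \in S -> b \in S -> directions b = directions a.
Proof.
move: {2}(ham a b) (erefl (ham a b)) => k; elim: k a => [|k IH] a hk aS bS.
  by move/eqP: hk; rewrite ham_eq0 => /eqP->.
have [|i ne iS] := isoS aS bS; first by rewrite -ham_eq0 hk.
rewrite -(directions_flip aS iS); apply: IH => //.
by move: hk; rewrite (ham_flip ne); case.
Qed.

(** A change of coordinate [i] would yield an edge of direction [i] somewhere, hence at every
    vertex. *)
Lemma agree_off (a b : cube n) i : a \in S -> b \in S -> i \notin directions a -> a i = b i.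
Proof.
move=> aS bS iD; apply/eqP/negPn/negP => ne.
have [x [xS xiS _ _]] := crossing isoS aS bS ne.
by move: iD; rewrite -(directions_const aS xS) inE xiS.
Qed.

(** The differing coordinates are flipped one by one; each is an available direction, and the
    available directions never change. *)
Lemma subcube_sub (a b : cube n) : a \in S ->
  (forall i, i \notin directions a -> a i = b i) -> b \in S.
Proof.
move: {2}(ham a b) (erefl (ham a b)) => k; elim: k a => [|k IH] a hk aS ab.
  by move/eqP: hk; rewrite ham_eq0 => /eqP<-.
have [i ne|e] := pickP (fun i => a i != b i); last first.
  suff : ham a b = 0 by rewrite hk.
  by apply: big1 => i _; rewrite e.
have iS : flip i a \in S.
  by have : i \in directions a; [apply: contraNT ne => /ab-> | rewrite inE].
apply: (IH (flip i a)) => //; first by move: hk; rewrite (ham_flip ne); case.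
move=> j; rewrite directions_flip // => jD; rewrite -ab // flipE.
by case: eqP jD => [->|]; rewrite ?addbF // inE iS.
Qed.

End SquareClosed.

(** * From a square-closed image to a hypercube *)

Section Forward.
Variables (T : finType) (e : rel T) (n : nat) (f : T -> cube n).
Hypothesis e_sym : symmetric e.
Hypothesis e_irr : irreflexive e.
Hypothesis f_dist : forall u v, dist e u v (ham (f u) (f v)).
Let S := image_set f.

Lemma card_directions u : #|directions S (f u)| = #|[set w | e u w]|.
Proof.
rewrite -(card_imset _ (@flip_inj _ (f u))) -(card_imset _ (f_inj f_dist)).
apply: eq_card => x; apply/imsetP/imsetP => [[i]|[w]].
  rewrite inE => /imsetP[w _ ew] ->; exists w => //.
  by rewrite inE (adjE e_irr f_dist) -ew ham_flip1.
rewrite inE (adjE e_irr f_dist) => /eqP/ham1P[i [_ ew]] ->; exists i => //.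
by rewrite inE -ew imset_f.
Qed.

(** The image is the subcube on the coordinates in [D]; restricting [f] to them loses nothing. *)
Lemma square_closed_cube (u0 : T) :
  (forall (a : cube n) i j, a \in S -> flip i a \in S -> flip j a \in S ->
    i != j -> flip i (flip j a) \in S) ->
  exists k, graph_iso e (@Qadj k).
Proof.
move=> sq; have isoS : isometric S by exact: image_isometric f_dist.
have SI u : f u \in S by rewrite imset_f.
pose D := directions S (f u0); exists #|D|.
pose g u : cube #|D| := [ffun t => f u (enum_val t)].
have off u v i : i \notin D -> f u i = f v i.
  move=> iD; apply: (agree_off isoS sq) => //.
  by rewrite -/(directions _ _) (directions_const isoS sq (SI u0)).
have hamg u v : ham (g u) (g v) = ham (f u) (f v).
  rewrite /ham (bigID (mem D)) /= [X in _ = _ + X]big1 ?addn0; last first.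
    by move=> i /(off u v) ->; rewrite eqxx.
  by rewrite [RHS]big_enum_val; apply: eq_bigr => t _; rewrite !ffunE.
have g_inj : injective g.
  by move=> u v e0; apply: (f_inj f_dist); apply/eqP; rewrite -ham_eq0 -hamg e0 hamxx.
exists g; split; last by move=> u v; rewrite QadjE hamg (adjE e_irr f_dist).
suff surj (b : cube #|D|) : exists u, g u == b.
  pose h b := xchoose (surj b).
  have hK : cancel h g by move=> b; apply/eqP; exact: xchooseP (surj b).
  by exists h => // u; apply: g_inj; rewrite hK.
pose b' : cube n :=
  [ffun i => if [pick t | enum_val t == i] is Some t then b t else f u0 i].
have /imsetP[u _ eu] : b' \in S.
  apply: (subcube_sub sq (SI u0)) => i iD; rewrite ffunE.
  by case: pickP => // t /eqP et; move: iD; rewrite -et enum_valP.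
exists u; apply/eqP/ffunP => t; rewrite !ffunE -eu ffunE.
by case: pickP => [t' /eqP/enum_val_inj-> //|/(_ t)]; rewrite eqxx.
Qed.

End Forward.

Theorem theorem1p1 (T : finType) (e : rel T)
  (e_sym : symmetric e) (e_irr : irreflexive e) (T_ne : 0 < #|T|)
  (pc : partial_cube e) (reg : regular e)
  (notK1 : ~ graph_iso e (@Kadj 1)) (notK2 : ~ graph_iso e (@Kadj 2)) :
  (forall c : seq T, convex_cycle e c -> size c = 4) <->
  (exists k, 2 <= k /\ graph_iso e (@Qadj k)).
Proof.
split=> [convex4|[k [_ [g [g_bij g_adj]]]] c]; last exact: cube_convex_cycle g_bij g_adj c.
have [n [f pcf]] := pc; have /card_gt0P[u0 _] := T_ne.
have f_dist u v : dist e u v (ham (f u) (f v)).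
  by have [d [ed /dist_ham <-]] := pcf u v.
have [r regr] := reg.
have [|k iso] := square_closed_cube e_irr f_dist u0.
  move=> a i j; apply: (@regular_square n (image_set f) _ r).
  - exact: image_betweenness_closed f_dist convex4.
  by move=> _ /imsetP[u _ ->]; rewrite -(regr u) -(card_directions e_irr f_dist).
(* For [k] at most 1 distinct vertices are adjacent, so the graph is complete on [2 ^ k] vertices,
   that is, [K_1] or [K_2]. *)
exists k; split=> //; rewrite ltnNge; apply/negP => k1.
have [g [g_bij g_adj]] := iso.
have cardT : #|T| = 2 ^ k.
  by rewrite (bij_eq_card g_bij) card_ffun card_bool card_ord.
have : graph_iso e (@Kadj #|T|).
  exists enum_rank; split=> [|x y]; first exact: enum_rank_bij.
  rewrite g_adj QadjE /Kadj (inj_eq enum_rank_inj) -(inj_eq (bij_inj g_bij)) -ham_eq0.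
  have : ham (g x) (g y) <= k.
    by rewrite ham_card -[X in _ <= X]card_ord max_card.
  by move: (ham _ _) => [|[|m]] //; lia.
by rewrite cardT; case: k k1 {iso g g_bij g_adj cardT} => [|[|]].
Qed.
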